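(* Assume that the continuous experiment/data matrix $\mathbf{A}$ is full rank. Then the first variations of the A-optimal objective $F^A[\rho]=\mathrm{Tr}\big((\mathbf{A}^\top\mathbf{A}[\rho])^{-1}\big)$ and of the D-optimal objective $F^D[\rho]=\log\big(\det(\mathbf{A}^\top\mathbf{A}[\rho])\big)$, $\rho\in\mathbf{Pr}_2(\Omega)$, are $$\frac{\delta F^A[\rho]}{\delta\rho}(\theta)=-\mathbf{A}(\theta,:)\big(\mathbf{A}^\top\mathbf{A}[\rho]\big)^{-2}\mathbf{A}(\theta,:)^\top,$$ $$\frac{\delta F^D[\rho]}{\delta\rho}(\theta)=\mathbf{A}(\theta,:)\big(\mathbf{A}^\top\mathbf{A}[\rho]\big)^{-1}\mathbf{A}(\theta,:)^\top .$$
   Context: $\Omega$ is a continuous design space (a subset of a Euclidean space), and $\mathbf{Pr}_2(\Omega)$ is the set of Borel probability measures $\rho$ on $\Omega$ with $\int_\Omega|\theta|^2\,d\rho(\theta)<\infty$. The continuous experiment/data matrix $\mathbf{A}$ has $d$ columns and ''rows'' indexed by $\theta\in\Omega$: for each $\theta\in\Omega$, $\mathbf{A}(\theta,:)$ is a real row vector with $d$ entries. ''Full rank'' means full column rank $d$, i.e. there is no nonzero $x\in\mathbb{R}^d$ with $\mathbf{A}(\theta,:)x=0$ for all $\theta\in\Omega$. For a (signed) measure $\mu$ on $\Omega$, $\mathbf{A}^\top\mathbf{A}[\mu]=\int_\Omega\mathbf{A}(\theta,:)^\top\mathbf{A}(\theta,:)\,d\mu(\theta)\in\mathbb{R}^{d\times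 d}$. First variation: given $\rho\in\mathbf{Pr}_2(\Omega)$, the first variation of a functional $F$ at $\rho$ is a function $\frac{\delta F[\rho]}{\delta\rho}:\Omega\to\mathbb{R}$ such that, for any signed measure $\eta$ with zero total mass ($\eta(\Omega)=0$) and for sufficiently small $\epsilon$ such that $\rho+\epsilon\eta\in\mathbf{Pr}_2(\Omega)$, one has $$F[\rho+\epsilon\eta]-F[\rho]=\epsilon\int_\Omega\frac{\delta F[\rho]}{\delta\rho}(\theta)\,d\eta(\theta)+o(\epsilon).$$
   Formalization: Full rank of A does not make AᵀA[ρ] invertible (e.g. ρ a Dirac mass, d ≥ 2), so invertibility of AᵀA[ρ] at the given ρ is assumed; the entries of A(θ,:)ᵀA(θ,:) are also assumed integrable for every measure in Pr₂(Ω), so that AᵀA is defined there. *)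

(* Defs.v *)
From HB Require Import structures.
From mathcomp Require Import all_boot all_order all_algebra.
From mathcomp Require Import all_classical all_reals all_analysis.
Set Implicit Arguments.
Unset Strict Implicit.
Unset Printing Implicit Defensive.
Import Order.TTheory GRing.Theory Num.Theory.
Import numFieldNormedType.Exports.
Local Open Scope classical_set_scope.
Local Open Scope ring_scope.

(* A nonempty subset Omega of R^m.  The proof of
   nonemptiness only serves to provide the default point that a measurableType
   requires.  The topology of 'rV[R]_m comes from the sup norm, hence it is the
   Euclidean one. *)
Definition design_space {R : realType} {m : nat} {Omega : set 'rV[R]_m}
  (Omega0 : Omega !=set0) : Type := set_type Omega.

HB.instance Definition _ {R : realType} {m : nat} {Omega : set 'rV[R]_m}
    (Omega0 : Omega !=set0) :=
  Choice.copy (design_space Omega0) (set_type Omega).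

HB.instance Definition _ {R : realType} {m : nat} {Omega : set 'rV[R]_m}
    (Omega0 : Omega !=set0) :=
  isPointed.Build (design_space Omega0)
    (exist _ (projT1 (cid Omega0)) (mem_set (projT2 (cid Omega0)))).

Definition subspace_open {R : realType} {m : nat} {Omega : set 'rV[R]_m}
    (Omega0 : Omega !=set0) : set (set (design_space Omega0)) :=
  @open (set_type Omega).
Arguments subspace_open {R m Omega} Omega0.

Notation borel_space Omega0 := (g_sigma_algebraType (subspace_open Omega0)).

Section signed_integral.
Context d (T : measurableType d) (R : realType).
Implicit Types (nu : {charge set T -> \bar R}) (f : T -> R).

Definition hahn_pos nu : set T := projT1 (cid (Hahn_decomposition nu)).

Definition hahn_neg nu : set T :=
  projT1 (cid (projT2 (cid (Hahn_decomposition nu)))).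

Definition hahnP nu : hahn_decomposition nu (hahn_pos nu) (hahn_neg nu) :=
  projT2 (cid (projT2 (cid (Hahn_decomposition nu)))).

Definition charge_integrable nu f : Prop :=
  (jordan_pos (hahnP nu)).-integrable setT (EFin \o f) /\
  (jordan_neg (hahnP nu)).-integrable setT (EFin \o f).

(* Meaningful only when f is charge_integrable. *)
Definition charge_integral nu f : R :=
  \int[jordan_pos (hahnP nu)]_x f x - \int[jordan_neg (hahnP nu)]_x f x.

End signed_integral.

Section design.
Context {R : realType} {m : nat} {Omega : set 'rV[R]_m}
  (Omega0 : Omega !=set0).
Local Notation X := (borel_space Omega0).
Local Notation signed := ({charge set X -> \bar R}).

Definition sqr_norm (theta : X) : R := \sum_(i < m) (set_val theta) ord0 i ^+ 2.

(* Pr_2(Omega), seen inside the signed measures. *)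
Definition Pr2 (mu : signed) : Prop :=
  exists P : probability X R,
    (forall B, measurable B -> mu B = P B) /\
    (\int[P]_theta (sqr_norm theta)%:E < +oo)%E.

Definition perturb (rho eta : signed) (eps : R) : signed :=
  cadd rho (cscale eps eta).

(* The integrability clause makes the (total) integral in the expansion
   meaningful; it is only required of directions eta for which rho + eps eta
   lies in Pr_2(Omega) for some eps != 0. *)
Definition first_variation (F : signed -> R) (rho : signed) (g : X -> R) : Prop :=
  forall eta : signed, eta setT = 0%E ->
    let D := [set eps : R | Pr2 (perturb rho eta eps)] in
    ((exists2 eps, eps != 0 & D eps) -> charge_integrable eta g) /\
    (forall eps : R, F (perturb rho eta eps) - F rho = eps * charge_integral eta g
       +o_(eps \near within D (nbhs (0 : R))) eps).

Context {d : nat} (A : X -> 'rV[R]_d).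

Definition full_rank : Prop :=
  forall x : 'cV[R]_d, (forall theta, A theta *m x = 0) -> x = 0.

Definition AtA (mu : signed) : 'M[R]_d :=
  \matrix_(i, j) charge_integral mu (fun theta => ((A theta)^T *m A theta) i j).

Definition AtA_defined (mu : signed) : Prop :=
  forall i j, charge_integrable mu (fun theta => ((A theta)^T *m A theta) i j).

Definition FA (mu : signed) : R := \tr (invmx (AtA mu)).

Definition FD (mu : signed) : R := ln (\det (AtA mu)).

End design.

(* Main.v *)
Require Import Defs.
From mathcomp Require Import all_boot all_order all_algebra.
From mathcomp Require Import all_classical all_reals all_analysis.
From mathcomp Require Import measurable_realfun.
Set Implicit Arguments.
Unset Strict Implicit.
Unset Printing Implicit Defensive.
Import Order.TTheory GRing.Theory Num.Theory.
Import numFieldNormedType.Exports.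
Local Open Scope classical_set_scope.
Local Open Scope ring_scope.

(** Write [M] for [AtA A rho] and [B] for [AtA A eta].  Integration against a
    signed measure is linear in the measure, so [AtA] of an admissible
    perturbation [rho + e eta] is [M + e B], and both expansions reduce to the
    derivative at [e = 0] of a function of the matrix pencil [M + e B].  For the
    trace of the inverse, the resolvent identity
    [(M + e B)^-1 - M^-1 = - e (M + e B)^-1 B M^-1] gives [- \tr (M^-2 B)]; for
    the determinant, Jacobi's formula gives [\det M * \tr (M^-1 B)], and the
    logarithm is differentiable at [\det M] because an invertible positive
    semidefinite matrix has a positive determinant.  A quadratic form
    [A(theta) N A(theta)^T] is [\tr (N A(theta)^T A(theta))], whose integral
    against [eta] is [\tr (N B)], which identifies the first variations. *)

(** * Integrals against sums, multiples and dominated measures *)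

Section measure_integral.
Local Open Scope ereal_scope.
Context d (T : measurableType d) (R : realType).
Implicit Types (mu : {measure set T -> \bar R}) (f : T -> \bar R).

(** Serves for Jordan parts, which are dominated by the two measures of any other decomposition of
    the charge. *)
Lemma integrable_le_measure mu1 mu2 f :
  (forall B, measurable B -> mu1 B <= mu2 B) ->
  mu2.-integrable setT f -> mu1.-integrable setT f.
Proof.
move=> mu12 /integrableP[mf foo]; apply/integrableP; split=> //.
apply: le_lt_trans foo; apply: ge0_le_measure_integral => //.
exact: measurableT_comp.
Qed.

Lemma integrable_mscale mu (k : {nonneg R}) f :
  mu.-integrable setT f -> (mscale k mu).-integrable setT f.
Proof.
move=> /integrableP[mf foo]; apply/integrableP; split=> //.
rewrite ge0_integral_mscale//; last exact: measurableT_comp.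
by rewrite lte_mul_pinfty// lee_fin.
Qed.

Lemma integral_mscale mu (k : {nonneg R}) f : mu.-integrable setT f ->
  \int[mscale k mu]_x f x = k%:num%:E * \int[mu]_x f x.
Proof.
move=> intf; have mf := measurable_int _ intf.
have mp := measurable_funepos mf; have mn := measurable_funeneg mf.
rewrite [LHS]integralE [X in _ = _ * X]integralE !ge0_integral_mscale//.
by rewrite [RHS]muleBr// integrable_add_def.
Qed.

Lemma integrable_measure_add mu1 mu2 f :
  mu1.-integrable setT f -> mu2.-integrable setT f ->
  (measure_add mu1 mu2).-integrable setT f.
Proof.
move=> /integrableP[mf foo1] /integrableP[_ foo2]; apply/integrableP; split=> //.
rewrite ge0_integral_measure_add//; last exact: measurableT_comp.
exact: lte_add_pinfty.
Qed.

Lemma Rintegral_measure_add mu1 mu2 (g : T -> R) :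
  mu1.-integrable setT (EFin \o g) -> mu2.-integrable setT (EFin \o g) ->
  (\int[measure_add mu1 mu2]_x g x = \int[mu1]_x g x + \int[mu2]_x g x)%R.
Proof.
move=> i1 i2; rewrite /Rintegral integral_measure_add// fineD//;
  exact: integrable_fin_num.
Qed.

Lemma Rintegral_mscale mu (k : {nonneg R}) (g : T -> R) :
  mu.-integrable setT (EFin \o g) ->
  (\int[mscale k mu]_x g x = k%:num * \int[mu]_x g x)%R.
Proof.
move=> ig; rewrite /Rintegral integral_mscale// fineM//.
exact: integrable_fin_num.
Qed.

End measure_integral.

(** * Integration against signed measures *)

Section charge_integral_theory.
Context d (T : measurableType d) (R : realType).
Implicit Types (nu : {charge set T -> \bar R}) (f g : T -> R).
Local Notation npos nu := (jordan_pos (hahnP nu)).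
Local Notation nneg nu := (jordan_neg (hahnP nu)).

Lemma jordan_pos_hahn nu B : measurable B -> npos nu B = nu (B `&` hahn_pos nu).
Proof.
by move=> mB; rewrite jordan_posE cjordan_posE /crestr0 mem_set// /crestr setIC.
Qed.

Lemma jordan_neg_hahn nu B : measurable B ->
  nneg nu B = (- nu (B `&` hahn_neg nu))%E.
Proof.
by move=> mB; rewrite jordan_negE cjordan_negE /crestr0 mem_set// /crestr setIC.
Qed.

Lemma hahn_measurable nu :
  measurable (hahn_pos nu) /\ measurable (hahn_neg nu).
Proof. by have [[? _] [? _] _ _] := hahnP nu. Qed.

Lemma jordan_decompB nu B : measurable B -> nu B = (npos nu B - nneg nu B)%E.
Proof. by move=> mB; rewrite (jordan_decomp (hahnP nu) mB) /cadd/= cscaleN1. Qed.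

(* The two sides of [nu^+ + mu2 = mu1 + nu^-] are equal measures. *)
Lemma charge_integral_diff nu (mu1 mu2 : {measure set T -> \bar R}) f :
  (forall B, measurable B -> nu B + mu2 B = mu1 B)%E ->
  mu1.-integrable setT (EFin \o f) -> mu2.-integrable setT (EFin \o f) ->
  charge_integrable nu f /\
  charge_integral nu f = \int[mu1]_x f x - \int[mu2]_x f x.
Proof.
move=> nuE i1 i2; have [mP mN] := hahn_measurable nu.
(* Minimality of the Jordan parts: on [B], [nu^+] is the [nu]-mass of the part of [B] in the
   positive Hahn set, which is at most its [mu1]-mass. Likewise [nu^-] lies below [mu2]. *)
have ip : (npos nu).-integrable setT (EFin \o f).
  apply: integrable_le_measure i1 => B mB; have mBP := measurableI _ _ mB mP.
  rewrite /= jordan_pos_hahn//; apply: (@le_trans _ _ (mu1 (B `&` hahn_pos nu))).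
    by rewrite -nuE// leeDl.
  by rewrite le_measure// inE.
have iN : (nneg nu).-integrable setT (EFin \o f).
  apply: integrable_le_measure i2 => B mB; have mBN := measurableI _ _ mB mN.
  rewrite /= jordan_neg_hahn//; apply: (@le_trans _ _ (mu2 (B `&` hahn_neg nu))).
    have : (0 <= mu1 (B `&` hahn_neg nu))%E by [].
    have := @fin_num_measure _ _ _ nu _ mBN.
    by rewrite -nuE// => /fineK <-; rewrite addeC -leeBlDr// sub0e.
  by rewrite le_measure// inE.
split => //; rewrite /charge_integral.
have : \int[measure_add (npos nu) mu2]_x f x =
       \int[measure_add mu1 (nneg nu)]_x f x.
  congr fine; apply: eq_measure_integral => B mB _.
  transitivity (npos nu B + mu2 B)%E; first exact: measure_addE.
  transitivity (mu1 B + nneg nu B)%E; last by rewrite -measure_addE.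
  rewrite -nuE// jordan_decompB//.
  have := @fin_num_measure _ _ _ (npos nu) _ mB.
  have := @fin_num_measure _ _ _ (nneg nu) _ mB.
  by move=> /fineK <- /fineK <-; rewrite addeAC subeK.
rewrite !Rintegral_measure_add// => e.
by apply/eqP; rewrite subr_eq addrAC -e addrK.
Qed.

(** Hahn sets are chosen charge by charge, so those of [nu1] and [nu2] may differ; the Jordan parts
    of [nu1] still decompose [nu2]. *)
Lemma eq_charge_integral nu1 nu2 f :
  (forall B, measurable B -> nu1 B = nu2 B) -> charge_integrable nu1 f ->
  charge_integrable nu2 f /\ charge_integral nu2 f = charge_integral nu1 f.
Proof.
move=> e [ip iN]; apply: charge_integral_diff => // B mB.
by rewrite -e// jordan_decompB// subeK// fin_num_measure.
Qed.

(** Adding Jordan parts decomposes the sum, in general not minimally; [charge_integral_diff] accepts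
    any decomposition. *)
Lemma charge_integral_cadd nu1 nu2 f :
  charge_integrable nu1 f -> charge_integrable nu2 f ->
  charge_integrable (cadd nu1 nu2) f /\
  charge_integral (cadd nu1 nu2) f = charge_integral nu1 f + charge_integral nu2 f.
Proof.
move=> [p1 n1] [p2 n2].
have [|||ia ->] := @charge_integral_diff (cadd nu1 nu2)
  (measure_add (npos nu1) (npos nu2)) (measure_add (nneg nu1) (nneg nu2)) f.
- move=> B mB; have addE mu1 mu2 : measure_add mu1 mu2 B = (mu1 B + mu2 B)%E.
    exact: measure_addE.
  rewrite [X in (_ + X = _)%E]addE [RHS]addE.
  rewrite [X in (X + _ = _)%E](_ : _ = nu1 B + nu2 B)%E//.
  rewrite (jordan_decompB nu1)// (jordan_decompB nu2)//.
  by rewrite addeACA subeK ?fin_num_measure// subeK ?fin_num_measure.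
- exact: integrable_measure_add.
- exact: integrable_measure_add.
by split=> //; rewrite !Rintegral_measure_add// /charge_integral opprD addrACA.
Qed.

Lemma charge_integral_cscale nu (c : R) f : charge_integrable nu f ->
  charge_integrable (cscale c nu) f /\
  charge_integral (cscale c nu) f = c * charge_integral nu f.
Proof.
move=> [ip iN].
have fP B mB := @fin_num_measure _ _ _ (npos nu) B mB.
have fN B mB := @fin_num_measure _ _ _ (nneg nu) B mB.
have sE (k : {nonneg R}) (mu : {measure set T -> \bar R}) B :
  mscale k mu B = (k%:num%:E * mu B)%E by [].
have [c0|c0] := leP 0 c.
  have [|||ia ->] := @charge_integral_diff (cscale c nu)
    (mscale (NngNum c0) (npos nu)) (mscale (NngNum c0) (nneg nu)) f.
  - move=> B mB; rewrite [X in (_ + X = _)%E]sE [RHS]sE /= /cscale (jordan_decompB nu)//.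
    by rewrite -(fineK (fP _ mB)) -(fineK (fN _ mB)) -!(EFinM, EFinB, EFinD) mulrBr subrK.
  - exact: integrable_mscale.
  - exact: integrable_mscale.
  by split=> //; rewrite !Rintegral_mscale// /charge_integral mulrBr.
(* For negative [c] the Jordan parts exchange roles, scaled by [- c]. *)
have {}c0 : 0 <= - c by rewrite oppr_ge0 ltW.
have [|||ia ->] := @charge_integral_diff (cscale c nu)
  (mscale (NngNum c0) (nneg nu)) (mscale (NngNum c0) (npos nu)) f.
- move=> B mB; rewrite [X in (_ + X = _)%E]sE [RHS]sE /= /cscale (jordan_decompB nu)//.
  rewrite -(fineK (fP _ mB)) -(fineK (fN _ mB)) -!(EFinM, EFinB, EFinD) mulrBr.
  by rewrite !mulNr addrAC subrr add0r.
- exact: integrable_mscale.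
- exact: integrable_mscale.
split=> //; rewrite !Rintegral_mscale// /charge_integral/=.
by rewrite !mulNr opprK mulrBr addrC.
Qed.

Lemma charge_integrable0 nu : charge_integrable nu (cst 0).
Proof. by split; exact: integrable0. Qed.

Lemma charge_integral0 nu : charge_integral nu (cst 0) = 0.
Proof. by rewrite /charge_integral !Rintegral_cst// !mul0r subrr. Qed.

Lemma charge_integralD nu f g :
  charge_integrable nu f -> charge_integrable nu g ->
  charge_integrable nu (fun x => f x + g x) /\
  charge_integral nu (fun x => f x + g x) =
    charge_integral nu f + charge_integral nu g.
Proof.
move=> [f1 f2] [g1 g2]; split; first by split; [exact: (integrableD measurableT f1 g1)|
  exact: (integrableD measurableT f2 g2)].
by rewrite /charge_integral !RintegralD// opprD addrACA.
Qed.

Lemma charge_integralZ nu (c : R) f : charge_integrable nu f ->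
  charge_integrable nu (fun x => c * f x) /\
  charge_integral nu (fun x => c * f x) = c * charge_integral nu f.
Proof.
move=> [f1 f2]; split; first by split; [exact: (integrableZl measurableT c f1)|
  exact: (integrableZl measurableT c f2)].
by rewrite /charge_integral !RintegralZl// -mulrBr.
Qed.

Lemma charge_integral_sum nu (I : Type) (s : seq I) (h : I -> T -> R) :
  (forall i, charge_integrable nu (h i)) ->
  charge_integrable nu (fun x => \sum_(i <- s) h i x) /\
  charge_integral nu (fun x => \sum_(i <- s) h i x) =
    \sum_(i <- s) charge_integral nu (h i).
Proof.
move=> ih; elim: s => [|i s [IHi IHs]].
  under eq_fun do rewrite big_nil.
  by rewrite big_nil; split; [exact: charge_integrable0|exact: charge_integral0].
under eq_fun do rewrite big_cons.
by rewrite big_cons -IHs; exact: charge_integralD.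
Qed.

(** The negative Jordan part vanishes: its value on [B] is minus a [nu]-mass. *)
Lemma charge_integral_ge0 nu f : (forall B, measurable B -> 0 <= nu B)%E ->
  (forall x, 0 <= f x) -> 0 <= charge_integral nu f.
Proof.
move=> nu0 f0; rewrite /charge_integral.
rewrite [X in _ - X](_ : _ = 0) ?subr0; first exact: Rintegral_ge0.
rewrite /Rintegral (eq_measure_integral (@mzero _ T R)) ?integral_measure_zero//.
move=> B mB _; apply/eqP; rewrite eq_le measure_ge0 andbT /= jordan_neg_hahn// /mzero.
by rewrite oppe_le0 nu0//; apply: measurableI => //; have [] := hahn_measurable nu.
Qed.

(* [eta] is recovered as [eps^-1 (mu - rho)], so that integrability against
   [rho] and against a single proper perturbation of it suffices. *)
Lemma charge_integral_perturb (rho eta mu : {charge set T -> \bar R}) (eps : R) f :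
  eps != 0 -> (forall B, mu B = rho B + eps%:E * eta B)%E ->
  charge_integrable rho f -> charge_integrable mu f ->
  charge_integrable eta f /\
  charge_integral mu f = charge_integral rho f + eps * charge_integral eta f.
Proof.
move=> eps0 muE irho imu.
have [iN eN] := charge_integral_cscale (-1) irho.
have [iD eD] := charge_integral_cadd imu iN.
have [iS eS] := charge_integral_cscale eps^-1 iD.
have [|ie ->] := @eq_charge_integral _ eta f _ iS.
  move=> B mB; rewrite [LHS](_ : _ = eps^-1%:E * (mu B + (-1)%:E * rho B))%E// muE.
  have := @fin_num_measure _ _ _ rho B mB => /fineK <-.
  have := @fin_num_measure _ _ _ eta B mB => /fineK <-.
  by rewrite -!(EFinM, EFinD) mulN1r addrAC subrr add0r mulKf.
by split=> //; rewrite eS mulVKf// eD eN mulN1r addrC subrK.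
Qed.

End charge_integral_theory.

(** * Derivatives along a matrix pencil *)

Section matrix_pencil.
Context {R : realType} {n : nat}.
Implicit Types (M B C N : 'M[R]_n).

(** Evaluation at [e] is a ring morphism, so determinants and adjugates of the pencil are
    evaluations of those of a polynomial matrix. *)
Lemma pencil_poly M B (e : R) :
  map_mx (horner_eval e) (map_mx polyC M + 'X *: map_mx polyC B) = M + e *: B.
Proof.
by apply/matrixP => i j; rewrite !mxE /horner_eval !hornerE.
Qed.

Lemma det_pencil M B :
  exists p : {poly R}, forall e, \det (M + e *: B) = p.[e].
Proof.
exists (\det (map_mx polyC M + 'X *: map_mx polyC B)) => e.
by rewrite -pencil_poly det_map_mx.
Qed.

Lemma trace_adj_pencil M B C :
  exists p : {poly R}, forall e, \tr (\adj (M + e *: B) *m C) = p.[e].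
Proof.
exists (\tr (\adj (map_mx polyC M + 'X *: map_mx polyC B) *m map_mx polyC C)) => e.
rewrite -[RHS]/(horner_eval e _) -trace_map_mx map_mxM map_mx_adj pencil_poly.
by congr (\tr (_ *m _)); apply/matrixP => i j; rewrite !mxE [RHS]hornerC.
Qed.

Lemma det_pencil_neq0 M B : M \in unitmx ->
  \forall e \near (0 : R), M + e *: B \in unitmx.
Proof.
have [p pE] := det_pencil M B; rewrite unitmxE unitfE => M0.
have p0 : p.[0] != 0 by rewrite -pE scale0r addr0.
have cp := @continuous_horner _ p 0.
near=> e; rewrite unitmxE unitfE pE; near: e.
exact: (@cvgr_neq0 _ _ _ _ _ _ _ cp p0).
Unshelve. all: by end_near. Qed.

(** By the adjugate formula, valid where the pencil is invertible and thus near [0], the trace is a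
    quotient of polynomials in [e]. *)
Lemma trace_inv_pencil_cvg M B C : M \in unitmx ->
  \tr (invmx (M + e *: B) *m C) @[e --> (0 : R)] --> \tr (invmx M *m C).
Proof.
move=> Mu; have [p pE] := det_pencil M B; have [q qE] := trace_adj_pencil M B C.
have M0 : \det M != 0 by rewrite -unitfE -unitmxE.
have ME : M = M + 0 *: B by rewrite scale0r addr0.
have invE e : M + e *: B \in unitmx ->
    (p.[e])^-1 * q.[e] = \tr (invmx (M + e *: B) *m C).
  by move=> eu; rewrite -pE -qE /invmx eu -scalemxAl mxtraceZ.
rewrite {2}ME -invE -?ME//; apply: cvg_trans.
  apply: near_eq_cvg; near=> e; apply: invE; near: e; exact: det_pencil_neq0.
apply: cvgM; last exact: continuous_horner.
by apply: cvgV; [rewrite -pE -ME|exact: continuous_horner].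
Unshelve. all: by end_near. Qed.

(* The difference quotient is [- \tr ((M + h B)^-1 B M^-1)] by the resolvent
   identity. *)
Lemma is_derive_trace_inv M B : M \in unitmx ->
  is_derive (0 : R) 1 (fun e => \tr (invmx (M + e *: B)))
    (- \tr (invmx M *m invmx M *m B)).
Proof.
move=> Mu; set f := fun e => _; set l := - _.
suff fl : h^-1 *: ((f \o shift 0) (h *: 1) - f 0) @[h --> 0^'] --> l.
  by apply: DeriveDef; [apply/cvg_ex; exists l|exact: cvg_lim fl].
have -> : l = - \tr (invmx M *m (B *m invmx M)).
  by rewrite mulmxA mxtrace_mulC mulmxA.
have cN : - \tr (invmx (M + h *: B) *m (B *m invmx M)) @[h --> 0^'] -->
    - \tr (invmx M *m (B *m invmx M)).
  apply: cvgN; apply: cvg_within_filter.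
  exact: trace_inv_pencil_cvg.
apply: cvg_trans cN.
apply: near_eq_cvg; near=> h.
have h0 : h != 0 by near: h; exact: nbhs_dnbhs_neq.
have hu : M + h *: B \in unitmx.
  by near: h; apply: nbhs_dnbhs; exact: det_pencil_neq0.
rewrite /f /= /shift addr0 scale0r addr0 [h *: 1]mulr1 -linearB/=.
have -> : invmx (M + h *: B) - invmx M =
    - h *: (invmx (M + h *: B) *m (B *m invmx M)).
  (* Inserting [M M^-1] in the first term and [(M + h B)^-1 (M + h B)] in the second leaves
     [M - (M + h B)] between common factors. *)
  rewrite -[X in X - _]mulmx1 -[X in _ *m X - _](mulmxV Mu).
  rewrite -[X in _ - X]mul1mx -[X in _ - X *m _](mulVmx hu).
  rewrite mulmxA -mulmxBl -mulmxBr opprD addrA subrr add0r.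
  by rewrite mulmxN -scalemxAr mulNmx scaleNr -scalemxAl mulmxA.
by rewrite mxtraceZ [h^-1 *: _]mulrA mulrN mulVf// mulN1r.
Unshelve. all: by end_near. Qed.

(* Up to the reversal [e |-> 1/e] this is the characteristic polynomial of
   [- N]. *)
Lemma det_1D_pencil N :
  exists2 p : {poly R}, (forall e, \det (1%:M + e *: N) = p.[e]) &
    p`_1 = \tr N.
Proof.
pose c := char_poly (- N).
(* Reversed coefficients of [c = \det (X + N)], since [\det (1 + e N) = e^n c(1/e)]. *)
exists (\poly_(i < n.+1) c`_(n - i)) => [e|]; last first.
  rewrite coef_poly ltnS; case: ltnP => [n0|].
    by rewrite subn1 char_poly_trace// raddfN opprK.
  (* For [n = 0] the coefficient is out of range and the trace is empty. *)
  move=> n0; rewrite /mxtrace big1// => i _;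
    by have := leq_ltn_trans (leq0n i) (ltn_ord i); rewrite ltnNge n0.
have cn : c`_n = 1.
  by have /monicP := char_poly_monic (- N); rewrite lead_coefE size_char_poly.
rewrite horner_poly; have [->|e0] := eqVneq e 0.
  rewrite scale0r addr0 det1 big_ord_recl/= subn0 cn expr0 mulr1 big1 ?addr0//.
  by move=> i _; rewrite expr0n mulr0.
have -> : 1%:M + e *: N = e *: map_mx (horner_eval e^-1) (char_poly_mx (- N)).
  apply/matrixP => i j; rewrite !mxE /horner_eval !hornerE !hornerMn hornerX.
  by rewrite mulrDr mulrnAr mulfV// opprK.
rewrite detZ det_map_mx -[X in _ * X]/(c.[e^-1]) horner_coef.
rewrite size_char_poly mulr_sumr (reindex_inj rev_ord_inj)/=.
apply: eq_bigr => i _; rewrite subSS mulrCA; congr (_ * _).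
have := leq_ord i => /subnK {1}<-.
by rewrite exprD exprVn mulrC mulKf// expf_neq0.
Qed.

(** Factoring out [\det M] leaves [\det (1 + e M^-1 B)], whose linear coefficient in [e] is a
    trace. *)
Lemma is_derive_det M B : M \in unitmx ->
  is_derive (0 : R) 1 (fun e => \det (M + e *: B))
    (\det M * \tr (invmx M *m B)).
Proof.
move=> Mu; have [p pE p1] := det_1D_pencil (invmx M *m B).
rewrite (_ : (fun e => _) = horner (\det M *: p)).
  apply: trigger_derive; rewrite derivZ hornerZ; congr (_ * _).
  by rewrite horner_coef0 coef_deriv p1.
apply/funext => e; rewrite hornerZ -pE -det_mulmx mulmxDr mulmx1.
by rewrite -scalemxAr mulKVmx.
Qed.

Lemma is_derive_ln_det M B : 0 < \det M ->
  is_derive (0 : R) 1 (fun e => ln (\det (M + e *: B))) (\tr (invmx M *m B)).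
Proof.
move=> M0; have Mu : M \in unitmx by rewrite unitmxE unitfE gt_eqF.
have ME : M + 0 *: B = M by rewrite scale0r addr0.
have d1 : is_derive (\det (M + 0 *: B)) 1 (@ln R) (\det M)^-1.
  by rewrite ME; exact: is_derive1_ln.
have := is_derive1_comp d1 (is_derive_det B Mu).
by rewrite mulKf// gt_eqF.
Qed.

(* [\det (1 - t + t M)] is a polynomial in [t] equal to [1] at [t = 0] and
   without root in [0, 1]. *)
Lemma det_gt0_psd M : (forall x : 'rV_n, 0 <= (x *m M *m x^T) ord0 ord0) ->
  M \in unitmx -> 0 < \det M.
Proof.
move=> psd Mu; have [p pE] := det_pencil 1%:M (M - 1%:M).
have p0 : p.[0] = 1 by rewrite -pE scale0r addr0 det1.
have p1 : p.[1] = \det M by rewrite -pE scale1r addrC subrK.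
rewrite -p1 ltNge; apply/negP => p1_le0.
(* [poly_ivt] takes a rise from a nonpositive to a nonnegative value, hence [- p]. *)
have [||t /andP[t0 t1] /rootP] := @poly_ivt R (- p) 0 1; first exact: ler01.
  by rewrite !hornerN p0 oppr_ge0 p1_le0 lerN10.
rewrite hornerN => /eqP; rewrite oppr_eq0 => /eqP pt0.
have /det0P[x x0 xP] : \det (1%:M + t *: (M - 1%:M)) == 0 by rewrite pE pt0.
(* Invertibility of [M] excludes [t = 1]; for [t < 1] the kernel vector gives
   [0 = (1 - t) |x|^2 + t x M x^T > 0]. *)
have [tE|tN1] := eqVneq t 1.
  by move: Mu; rewrite unitmxE unitfE -p1 -tE pt0 eqxx.
have : ((x *m (1%:M + t *: (M - 1%:M))) *m x^T) ord0 ord0 = 0.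
  by rewrite xP mul0mx mxE.
have -> : 1%:M + t *: (M - 1%:M) = (1 - t) *: 1%:M + t *: M.
  by rewrite scalerBr scalerBl scale1r addrCA addrC addrAC.
rewrite mulmxDr mulmxDl -!scalemxAr mulmx1 -!scalemxAl mxE [X in X + _]mxE [X in _ + X]mxE.
have sq : 0 < (x *m x^T) ord0 ord0.
  rewrite lt_def; apply/andP; split; last first.
    by rewrite mxE sumr_ge0// => i _; rewrite mxE -expr2 sqr_ge0.
  apply: contra_neq x0; rewrite mxE => /eqP; rewrite psumr_eq0 => [/allP x0|i _].
    apply/rowP => i; rewrite mxE; apply/eqP.
    by have := x0 i (mem_index_enum _); rewrite mxE /= -expr2 sqrf_eq0.
  by rewrite mxE -expr2 sqr_ge0.
move/eqP; apply/negP; rewrite gt_eqF// ltr_pwDl//.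
  by rewrite mulr_gt0// subr_gt0 lt_neqAle tN1.
by rewrite mulr_ge0.
Qed.

End matrix_pencil.

(** * Quadratic forms as traces, and expansions from derivatives *)

Lemma charge_integral_trace d (T : measurableType d) (R : realType)
    (nu : {charge set T -> \bar R}) n (N : 'M[R]_n) (F : T -> 'M[R]_n) :
  (forall i j, charge_integrable nu (fun x => F x i j)) ->
  charge_integrable nu (fun x => \tr (N *m F x)) /\
  charge_integral nu (fun x => \tr (N *m F x)) =
    \tr (N *m \matrix_(i, j) charge_integral nu (fun x => F x i j)).
Proof.
move=> iF.
have trE G : \tr (N *m G) = \sum_i \sum_j N i j * G j i.
  by apply: eq_bigr => i _; rewrite mxE.
under eq_fun do rewrite trE.
pose h i x := \sum_j N i j * F x j i.
have hP i : charge_integrable nu (h i) /\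
    charge_integral nu (h i) = \sum_j N i j * charge_integral nu (fun x => F x j i).
  have [ih ->] := @charge_integral_sum _ _ _ nu _ (index_enum _)
    (fun j x => N i j * F x j i) (fun j => (charge_integralZ (N i j) (iF j i)).1).
  split=> //; apply: eq_bigr => j _; exact: (charge_integralZ _ (iF j i)).2.
have [ih ->] := charge_integral_sum (index_enum _) (fun i => (hP i).1).
split=> //; rewrite trE; apply: eq_bigr => i _; rewrite (hP i).2.
by apply: eq_bigr => j _; rewrite mxE.
Qed.

Lemma row_quad_trace (R : comPzRingType) n (N : 'M[R]_n) (a : 'rV_n) :
  (a *m N *m a^T) ord0 ord0 = \tr (N *m (a^T *m a)).
Proof. by rewrite -trace_mx11 -mulmxA mxtrace_mulC -mulmxA. Qed.

(** [s] is tied to [c] only when [D] has a nonzero point; otherwise the expansion is tested at most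
    at [e = 0], where both sides vanish. *)
Lemma derive_within_littleo (R : realType) (D : set R) (phi f : R -> R) (c s : R) :
  is_derive (0 : R) 1 phi c ->
  (forall e, D e -> f e = phi e - phi 0) ->
  (forall e, D e -> e != 0 -> s = c) ->
  forall e, f e = e * s +o_(e \near within D (nbhs (0 : R))) e.
Proof.
move=> [dphi phic] fE sE.
suff : f = (fun e => e * s) +o_ (within D (nbhs (0 : R))) id.
  by rewrite funeqE => fo; apply: eqaddoEx => e; have /= -> := fo e.
apply/eqaddoP => _/posnumP[eps].
have /eqaddoP/(_ eps%:num)/(_ [gt0 of eps%:num]) := derivable_nbhs dphi.
rewrite phic near_withinE; apply: filter_app; near=> e => /= lephi De.
move: lephi; rewrite !fctE /= [e *: 1]mulr1 addr0.
have [e0|e0] := eqVneq e 0.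
  by rewrite fE// e0 subrr mul0r subr0 !normr0 mulr0.
by rewrite fE// (sE e De e0) opprD addrA.
Unshelve. all: by end_near. Qed.

(** * First variations of functions of the information matrix *)

Section information_matrix.
Context {R : realType} {m : nat} {Omega : set 'rV[R]_m}
  (Omega0 : Omega !=set0).
Local Notation X := (borel_space Omega0).
Local Notation signed := ({charge set X -> \bar R}).
Context {d : nat} (A : X -> 'rV[R]_d).

Lemma AtA_perturb (rho eta : signed) (e : R) : e != 0 ->
  AtA_defined A rho -> AtA_defined A (perturb rho eta e) ->
  AtA_defined A eta /\ AtA A (perturb rho eta e) = AtA A rho + e *: AtA A eta.
Proof.
move=> e0 irho imu.
have H i j := @charge_integral_perturb _ _ _ rho eta (perturb rho eta e) e _ e0
  (fun=> erefl) (irho i j) (imu i j).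
by split=> [i j|]; [exact: (H i j).1|apply/matrixP => i j; rewrite !mxE (H i j).2].
Qed.

Lemma perturb0 (rho eta : signed) B : perturb rho eta 0 B = rho B.
Proof. by rewrite [LHS](_ : _ = rho B + 0%:E * eta B)%E// mul0e adde0. Qed.

(** Separate from [AtA_perturb], because a zero step gives no integrability against [eta]. *)
Lemma AtA_perturb0 (rho eta : signed) : AtA_defined A rho ->
  AtA A (perturb rho eta 0) = AtA A rho.
Proof.
move=> irho; apply/matrixP => i j; rewrite !mxE.
have [|//] := @eq_charge_integral _ _ _ rho (perturb rho eta 0) _ _ (irho i j).
by move=> B _; rewrite perturb0.
Qed.

(** The form is the integral of the square of the scalar [A t *m x^T]. *)
Lemma AtA_psd (mu : signed) (x : 'rV[R]_d) : Pr2 mu -> AtA_defined A mu ->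
  0 <= (x *m AtA A mu *m x^T) ord0 ord0.
Proof.
move=> [P [muP _]] imu.
rewrite -trace_mx11 mxtrace_mulC mulmxA.
have [_ <-] := charge_integral_trace (x^T *m x) imu.
apply: charge_integral_ge0 => [B mB|t]; first by rewrite muP.
rewrite -mulmxA mxtrace_mulC -!mulmxA mulmxA trace_mx11 mxE big_ord1.
rewrite -[A t *m x^T]trmxK trmx_mul trmxK [X in _ * X]mxE -expr2.
exact: sqr_ge0.
Qed.

(** Common frame for both objectives: [N] represents the differential of [phi] at [AtA A rho]
    through the trace pairing. *)
Lemma first_variation_trace (F : signed -> R) (rho : signed)
    (phi : 'M[R]_d -> R) (N : 'M[R]_d) :
  (forall mu, Pr2 mu -> AtA_defined A mu) -> Pr2 rho ->
  (forall mu, F mu = phi (AtA A mu)) ->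
  (forall B, is_derive (0 : R) 1 (fun e => phi (AtA A rho + e *: B)) (\tr (N *m B))) ->
  first_variation F rho (fun t => (A t *m N *m (A t)^T) ord0 ord0).
Proof.
move=> iA rhoPr FE dphi eta eta0 D.
under [X in charge_integrable eta X]eq_fun do rewrite row_quad_trace.
under [X in charge_integral eta X]eq_fun do rewrite row_quad_trace.
have irho := iA _ rhoPr.
have etaP e : e != 0 -> D e -> AtA_defined A eta /\
    AtA A (perturb rho eta e) = AtA A rho + e *: AtA A eta.
  by move=> e0 De; apply: AtA_perturb => //; exact: iA.
split=> [[e e0 De]|].
  exact: (charge_integral_trace N (etaP _ e0 De).1).1.
apply: derive_within_littleo (dphi (AtA A eta)) _ _ => [e De|e De e0].
  rewrite !FE scale0r addr0; have [->|e0] := eqVneq e 0.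
    by rewrite AtA_perturb0// scale0r addr0.
  by rewrite (etaP _ e0 De).2.
exact: (charge_integral_trace N (etaP _ e0 De).1).2.
Qed.

End information_matrix.

Theorem proposition3p1 (R : realType) (m d : nat) (Omega : set 'rV[R]_m)
    (Omega0 : Omega !=set0) (A : borel_space Omega0 -> 'rV[R]_d)
    (A_defined : forall mu : {charge set borel_space Omega0 -> \bar R},
        Pr2 mu -> AtA_defined A mu)
    (A_full_rank : full_rank A)
    (rho : {charge set borel_space Omega0 -> \bar R})
    (rho_Pr2 : Pr2 rho)
    (rho_inv : AtA A rho \in unitmx) :
  first_variation (FA A) rho
    (fun theta =>
       - (A theta *m invmx (AtA A rho) ^+ 2 *m (A theta)^T) ord0 ord0) /\
  first_variation (FD A) rho
    (fun theta =>
       (A theta *m invmx (AtA A rho) *m (A theta)^T) ord0 ord0).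
Proof.
split; last first.
  apply: (@first_variation_trace _ _ _ _ _ A _ _ (fun M => ln (\det M))) => // B.
  apply: is_derive_ln_det; apply: det_gt0_psd => // x.
  by apply: AtA_psd => //; exact: A_defined.
(* The sign moves into the matrix, giving [N = - M^-2]. *)
rewrite (_ : (fun _ => _) = fun theta =>
    (A theta *m (- invmx (AtA A rho) ^+ 2) *m (A theta)^T) ord0 ord0); last first.
  by apply/funext => theta; rewrite mulmxN mulNmx [RHS]mxE.
apply: (@first_variation_trace _ _ _ _ _ A _ _ (fun M => \tr (invmx M))) => // B.
rewrite mulNmx linearN expr2; exact: is_derive_trace_inv.
Qed.
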